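(* Let $n\ge 1$ and let $\gamma_n^1$ be the total space of the canonical line bundle over the Grassmannian $G_n^1$ of lines through the origin in $\mathbb R^n$. Let $V_1,\dots,V_{n+1}\subseteq\gamma_n^1$ be closed subsets such that for every $L\in G_n^1$ and every $i$, the intersection $V_i\cap L$ of $V_i$ with the fiber over $L$ is a non-empty segment (possibly a single point), and $V_i\cap L$ depends continuously on $L$ in the Hausdorff metric. Then at least one of the following holds: 1) there exist $L\in G_n^1$ and $i\in\{1,\dots,n+1\}$ such that $V_i\cap L\subseteq V_j\cap L$ for every $j\neq i$; 2) for every partition of the family $\{V_1,\dots,V_{n+1}\}$ into two non-empty subfamilies $\mathcal F_1,\mathcal F_2$ there is $L\in G_n^1$ such that the families of segments $\mathcal F_1(L)=\{U\cap L: U\in\mathcal F_1\}$ and $\mathcal F_2(L)=\{U\cap L: U\in\mathcal F_2\}$ are equalized in the line $L$.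
   Context: The total space $\gamma_n^1$ consists of pairs $(L,x)$ with $L\in G_n^1$ and $x\in L$; the fiber over $L$ is identified with the line $L$. Two families of segments $\mathcal A,\mathcal B$ in a real line (with a chosen direction, ''left'' and ''right'') are called equalized if one of the following holds: (a) all right endpoints of segments of $\mathcal A$ coincide at a point $a$, all left endpoints of segments of $\mathcal B$ coincide at a point $b$, and either $a$ is to the left of $b$ or every segment of $\mathcal A\cup\mathcal B$ contains the segment $[b,a]$; (b) the same with the roles of $\mathcal A$ and $\mathcal B$ exchanged (all right endpoints of $\mathcal B$ coincide at $b$, all left endpoints of $\mathcal A$ coincide at $a$, and either $b$ is to the left of $a$ or every segment of $\mathcal A\cup\mathcal B$ contains $[a,b]$). *)

(* Defs.v *)
From HB Require Import structures.
From mathcomp Require Import all_boot all_order all_algebra.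
From mathcomp Require Import all_classical all_reals all_analysis.

Set Implicit Arguments.
Unset Strict Implicit.
Unset Printing Implicit Defensive.

Import Order.TTheory GRing.Theory Num.Theory.
Import numFieldNormedType.Exports.

Local Open Scope classical_set_scope.
Local Open Scope ring_scope.

Definition grassmannian1 (R : realType) (n : nat) : Type :=
  {L : {vspace 'rV[R]_n} | \dim L == 1%N}.

HB.instance Definition _ (R : realType) (n : nat) :=
  Choice.on (grassmannian1 R n).

Section GrassmannianTopology.
Context (R : realType) (n : nat).

(* The quotient topology for the map v |-> <[v]> from R^n \ {0}. A vector v in
   the set below is nonzero because <[v]> has dimension 1, and R^n \ {0} is
   open in R^n, so openness can be tested in R^n. *)
Definition grassmannian1_open (U : set (grassmannian1 R n)) : Prop :=
  open [set v : 'rV[R]_n | exists2 L, U L & sval L = <[v]>%VS].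

Let spanned (v : 'rV[R]_n) : v != 0 ->
  exists L : grassmannian1 R n, sval L = <[v]>%VS.
Proof.
move=> v0; have dv : \dim <[v]>%VS == 1%N by rewrite dim_vline v0.
by exists (exist _ <[v]>%VS dv).
Qed.

Let grassmannian1_openT : grassmannian1_open setT.
Proof.
rewrite /grassmannian1_open.
have -> : [set v : 'rV[R]_n | exists2 L : grassmannian1 R n, setT L &
    sval L = <[v]>%VS] =
    \bigcup_(j in [set: 'I_n])
      ((fun v : 'rV[R]_n => v ord0 j) @^-1` [set x | x != 0]).
  apply/seteqP; split=> v /=.
    move=> [L _ eL].
    have v0 : v != 0.
      have := valP L; rewrite /= eL dim_vline.
      by case: (v != 0).
    apply: contrapT => hv; case/eqP: v0; apply/rowP => j; rewrite mxE.
    by apply/eqP/negPn/negP => vj; apply: hv; exists j.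
  move=> [j _ /= vj]; have /spanned[L eL] : v != 0.
    by apply: contraNneq vj => ->; rewrite mxE.
  by exists L.
apply: bigcup_open => j _; apply: open_comp; last exact: open_neq.
by move=> v _; exact: coord_continuous.
Qed.

Let grassmannian1_openI : setI_closed grassmannian1_open.
Proof.
move=> A B oA oB; rewrite /grassmannian1_open.
have := openI oA oB; congr (open _); apply/seteqP; split=> v /=.
  move=> [[L AL eL] [M BM eM]]; exists L => //; split => //.
  by have -> : L = M by apply: val_inj; exact: (etrans eL (esym eM)).
by move=> [L [AL BL] eL]; split; exists L.
Qed.

Let grassmannian1_open_bigcup (I : Type) (f : I -> set (grassmannian1 R n)) :
  (forall i, grassmannian1_open (f i)) -> grassmannian1_open (\bigcup_i f i).
Proof.
move=> fo; rewrite /grassmannian1_open.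
have := @bigcup_open _ I setT _ (fun i _ => fo i).
congr (open _); apply/seteqP; split=> v /=.
  by move=> [i _ [L fL eL]]; exists L => //; exists i.
by move=> [L [i _ fL] eL]; exists i => //; exists L.
Qed.

HB.instance Definition _ := isOpenTopological.Build (grassmannian1 R n)
  grassmannian1_openT grassmannian1_openI grassmannian1_open_bigcup.

End GrassmannianTopology.

(* As a type (via [set_type]), this set carries the subspace topology of
   G_n^1 x R^n. *)
Definition canonical_line_bundle (R : realType) (n : nat) :
    set (grassmannian1 R n * 'rV[R]_n)%type :=
  [set p : grassmannian1 R n * 'rV[R]_n | p.2 \in sval p.1].

Arguments canonical_line_bundle : clear implicits.

Definition fiber (R : realType) (n : nat)
    (V : set (canonical_line_bundle R n)) (L : grassmannian1 R n) :
    set 'rV[R]_n :=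
  [set x | exists2 p, V p & set_val p = (L, x)].

(* The library norm on 'rV[R]_n is the sup norm, hence this definition. *)
Definition euclidean_dist (R : realType) (n : nat) (x y : 'rV[R]_n) : R :=
  Num.sqrt (\sum_(j < n) (x ord0 j - y ord0 j) ^+ 2).

Definition hausdorff_dist (R : realType) (n : nat) (A B : set 'rV[R]_n) :
    \bar R :=
  maxe
    (ereal_sup [set ereal_inf [set (euclidean_dist x y)%:E | y in B] | x in A])
    (ereal_sup [set ereal_inf [set (euclidean_dist x y)%:E | x in A] | y in B]).

Definition hausdorff_continuous (R : realType) (n : nat)
    (S : grassmannian1 R n -> set 'rV[R]_n) : Prop :=
  forall L0 : grassmannian1 R n,
    hausdorff_dist (S L) (S L0) @[L --> L0] --> 0%E.

Definition segment (R : realType) (n : nat) (p q : 'rV[R]_n) : set 'rV[R]_n :=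
  [set (1 - t) *: p + t *: q | t in `[0, 1]%classic].

Definition is_segment (R : realType) (n : nat) (S : set 'rV[R]_n) : Prop :=
  exists p q, S = segment p q.

Section Equalized.
Context (R : realType) (n : nat).

(* All points below lie on one line, directed by the nonzero vector [u], which
   points to the right. *)
Variable u : 'rV[R]_n.

Definition left_of (x y : 'rV[R]_n) : Prop :=
  exists2 t : R, 0 < t & y = x + t *: u.

Definition right_endpoint (S : set 'rV[R]_n) (p : 'rV[R]_n) : Prop :=
  S p /\ forall x, S x -> x = p \/ left_of x p.

Definition left_endpoint (S : set 'rV[R]_n) (p : 'rV[R]_n) : Prop :=
  S p /\ forall x, S x -> x = p \/ left_of p x.

Definition equalized_a (A B : set (set 'rV[R]_n)) : Prop :=
  exists a b : 'rV[R]_n,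
    [/\ forall S, A S -> right_endpoint S a,
        forall S, B S -> left_endpoint S b &
        left_of a b \/ forall S, (A `|` B) S -> segment b a `<=` S].

(* Reversing the direction [u] exchanges the two disjuncts, so being equalized
   does not depend on the choice of the direction. *)
Definition equalized (A B : set (set 'rV[R]_n)) : Prop :=
  equalized_a A B \/ equalized_a B A.

End Equalized.

(* Main.v *)
(* In terms of the left ends l_i(v) of the segments over the line spanned by v,
   oriented by v, let C_i be the closed set of v where l_i is the largest left
   end. The C_i cover the sphere, and -C_j is the set where the right end of
   V_j is the smallest one. If some C_i contains antipodal points, V_i lies in
   all the other segments. Otherwise the map with coordinates
   K_i = (g_i(-v) - g_i(v)) / (g_i(-v) + g_i(v)), g_i = max_j l_j - l_i, is odd,
   takes values in [-1, 1], equals 1 on C_i and -1 on -C_i, and always has a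
   coordinate 1 and a coordinate -1. By Borsuk-Ulam applied to the n - 1
   differences inside the two classes, K is constant on F1 and on F2 at some v;
   then v or -v lies in every C_i, i in F1, and in every -C_j, j in F2, which
   equalizes the two families.
   Borsuk-Ulam is proved with chains modulo 2: for odd sign functions
   s_0, .., s_k, the cochain s_0 u ds_1 u .. u ds_k plus its antipode is
   ds_1 u .. u ds_k, so by induction on k the latter takes the value 1 on every
   subdivision of the k-dimensional hemisphere. For the signs of the coordinates
   of f this gives arbitrarily small simplices on which all of them change
   sign. *)
Require Import Defs.
From mathcomp Require Import all_boot all_order all_algebra.
From mathcomp Require Import all_classical all_reals all_analysis.
From mathcomp Require Import ring lra.

Set Implicit Arguments.
Unset Strict Implicit.
Unset Printing Implicit Defensive.

Import Order.TTheory GRing.Theory Num.Theory.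
Import numFieldNormedType.Exports.

Local Open Scope classical_set_scope.
Local Open Scope ring_scope.

(** * Chains modulo 2 *)

(* A chain modulo 2 is a sequence [C] of ordered simplices, repetitions being
   allowed; only the values [parity C phi] of cochains on it matter. *)
Definition parity (T : Type) (C : seq T) (phi : T -> bool) : bool :=
  \big[addb/false]_(s <- C) phi s.

Section Parity.
Variables T U : Type.
Implicit Types (C D : seq T) (phi psi : T -> bool).

Lemma parity_cons s C phi : parity (s :: C) phi = phi s (+) parity C phi.
Proof. by rewrite /parity big_cons. Qed.

Lemma parity_nil phi : parity [::] phi = false.
Proof. by rewrite /parity big_nil. Qed.

Lemma parity_map C (f : T -> U) (phi : U -> bool) :
  parity (map f C) phi = parity C (phi \o f).
Proof. by rewrite /parity big_map. Qed.

Lemma parity_cat C D phi :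
  parity (C ++ D) phi = parity C phi (+) parity D phi.
Proof. by rewrite /parity big_cat. Qed.

Lemma eq_parity C phi psi : phi =1 psi -> parity C phi = parity C psi.
Proof. by move=> e; apply: eq_bigr. Qed.

Lemma parity_add C phi psi :
  parity C (fun s => phi s (+) psi s) = parity C phi (+) parity C psi.
Proof. by rewrite /parity big_split. Qed.

Lemma parity_andl C b phi :
  parity C (fun s => b && phi s) = b && parity C phi.
Proof.
by case: b => /=; [exact: eq_parity|rewrite /parity big1].
Qed.

End Parity.

Lemma parity_flatten (T U : Type) (C : seq T) (f : T -> seq U) phi :
  parity (flatten (map f C)) phi = parity C (fun s => parity (f s) phi).
Proof.
elim: C => [|s C IH] /=; first by rewrite !parity_nil.
by rewrite parity_cat IH parity_cons.
Qed.

Section Chains.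
Variable V : Type.
Implicit Types (x y : V) (s t : seq V) (C : seq (seq V)) (phi : seq V -> bool).

Fixpoint faces s : seq (seq V) :=
  if s is x :: s' then s' :: map (cons x) (faces s') else [::].

(* The complex is augmented: the only face of [[:: x]] is [[::]]. *)
Definition cobd phi s := parity (faces s) phi.

Lemma cobd_cons phi x s :
  cobd phi (x :: s) = phi s (+) cobd (phi \o cons x) s.
Proof. by rewrite /cobd /= /parity big_cons big_map. Qed.

Lemma cobd_add phi psi s :
  cobd (fun t => phi t (+) psi t) s = cobd phi s (+) cobd psi s.
Proof. exact: parity_add. Qed.

Lemma cobd_cobd phi s : cobd (cobd phi) s = false.
Proof.
elim: s phi => [|x s IH] phi; first by rewrite /cobd /= /parity big_nil.
rewrite cobd_cons (_ : cobd phi \o cons x =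
  fun t => phi t (+) cobd (phi \o cons x) t); last first.
  by apply/funext => t; rewrite /= cobd_cons.
by rewrite cobd_add IH addbF addbb.
Qed.

Variables (I : Type) (g : I -> V -> bool).

(* Cup product of the coboundaries of the sign functions [g i], [i] in [r]. *)
Fixpoint alternates (r : seq I) s : bool :=
  match r, s with
  | [::], [:: _] => true
  | i :: r', x :: ((y :: _) as s') => (g i x (+) g i y) && alternates r' s'
  | _, _ => false
  end.

(** This is the cocycle property of [alternates r]: modulo 2, the faces of [x :: y :: s] that keep
    [x] balance the one that omits it. In the induction step, the jump from [x] to [z] is the sum of
    the jumps from [x] to [y] and from [y] to [z]. *)
Lemma cobd_alternates_cons r x y s : size s = size r ->
  cobd (alternates r \o cons x) (y :: s) = alternates r (y :: s).
Proof.
elim: r x y s => [|i r IH] x y [|z s] //= => [_|[r_s]].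
  by rewrite cobd_cons /= /cobd /= /parity big_nil.
rewrite cobd_cons [X in _ (+) X]parity_andl -/(cobd (alternates r \o cons y) _).
rewrite IH //=; by case: alternates; case: (g i x); case: (g i y); case: (g i z).
Qed.

(** Leibniz rule: the cochain on the left is the cup product of the 0-cochain [g i], read off the
    first vertex, with the cocycle [alternates r], so only the coboundary of [g i] contributes. *)
Lemma cobd_alternates i r s : size s = (size r).+2 ->
  cobd (fun t => head false (map (g i) t) && alternates r t) s =
  alternates (i :: r) s.
Proof.
case: s => [|x [|y s]] //= [r_s].
rewrite cobd_cons [X in _ (+) X]parity_andl -/(cobd (alternates r \o cons x) _).
rewrite cobd_alternates_cons //=.
by case: alternates; case: (g i x); case: (g i y).
Qed.

End Chains.

(** * Barycentric subdivision *)

Section Subdivision.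
Variables (R : realType) (V : normedModType R).
Implicit Types (s t : seq V) (phi : seq V -> bool) (P : V -> Prop).

Definition barycenter s : V := (size s)%:R^-1 *: \sum_(x <- s) x.

(** The counter [n] makes the recursion through the faces structural; started at [size s], it runs
    out exactly at the empty simplex. *)
Fixpoint sdn n s : seq (seq V) :=
  if n is m.+1
  then map (cons (barycenter s)) (flatten (map (sdn m) (faces s)))
  else [:: s].

Definition sd s := sdn (size s) s.

Definition antipode s := map (@GRing.opp V) s.

Lemma antipodeK : involutive antipode.
Proof. by move=> s; rewrite /antipode -map_comp (eq_map opprK) map_id. Qed.

Lemma size_faces s t : t \in faces s -> size s = (size t).+1.
Proof.
elim: s t => //= x s IH t; rewrite inE => /predU1P[->//|/mapP[t' /IH -> ->]].
by [].
Qed.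

Lemma faces_sub s t : t \in faces s -> {subset t <= s}.
Proof.
elim: s t => //= x s IH t; rewrite inE => /predU1P[-> y ys|/mapP[t' t's ->] y].
  by rewrite inE ys orbT.
by rewrite !inE => /predU1P[->|/(IH _ t's) ->]; rewrite ?eqxx ?orbT.
Qed.

Lemma faces_antipode s : faces (antipode s) = map antipode (faces s).
Proof.
by elim: s => //= x s ->; rewrite -!map_comp.
Qed.

Lemma cobd_antipode phi s : cobd phi (antipode s) = cobd (phi \o antipode) s.
Proof. by rewrite /cobd faces_antipode parity_map. Qed.

Lemma barycenter_antipode s : barycenter (antipode s) = - barycenter s.
Proof. by rewrite /barycenter size_map big_map sumrN scalerN. Qed.

Lemma sd_cons x s :
  sd (x :: s) = map (cons (barycenter (x :: s))) (flatten (map sd (faces (x :: s)))).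
Proof.
congr (map _ (flatten _)); by apply/eq_in_map => t /size_faces[e]; rewrite /sd -e.
Qed.

Lemma sd_antipode s : sd (antipode s) = map antipode (sd s).
Proof.
have [n] := ubnP (size s); elim: n s => // n IH [|x s] //= s_n.
rewrite [antipode _]/= !sd_cons -[_ :: map _ _]/(antipode (x :: s)).
rewrite faces_antipode barycenter_antipode -!map_comp !map_flatten.
congr flatten; rewrite -!map_comp; apply/eq_in_map => t ts /=.
rewrite IH -?map_comp //; by rewrite -ltnS -(size_faces ts).
Qed.

(* Subdivision is a chain map modulo 2: coning from the barycenter is a
   contraction, and [cobd_cobd] kills the remaining term. *)
Lemma parity_sd_cobd phi s :
  parity (sd s) (cobd phi) = cobd (fun t => parity (sd t) phi) s.
Proof.
have [n] := ubnP (size s); elim: n s phi => // n IH [|x s] phi s_n.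
  by rewrite /sd /= parity_cons parity_nil /cobd /= !parity_nil.
rewrite sd_cons parity_map parity_flatten.
rewrite -[RHS]addbF -(cobd_cobd (fun t => parity (sd t)
  (phi \o cons (barycenter (x :: s)))) (x :: s)) -cobd_add [RHS]/cobd.
apply: eq_big_seq => t ts /=.
rewrite -IH; last by rewrite -ltnS -(size_faces ts).
by rewrite -parity_add; apply: eq_parity => u /=; rewrite cobd_cons.
Qed.

Lemma size_sd s t : t \in sd s -> size t = size s.
Proof.
have [n] := ubnP (size s); elim: n s t => // n IH [|x s] t s_n.
  by rewrite inE => /eqP ->.
rewrite sd_cons => /mapP[u /flatten_mapP[v vs uv] ->] /=.
by rewrite (IH v u) -?(size_faces vs) // -ltnS -(size_faces vs).
Qed.

(** The only consequence of convexity that subdivision needs. *)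
Definition barycentric P := forall s, s != [::] ->
  {in s, forall x, P x} -> P (barycenter s).

Lemma sd_barycentric P s t : barycentric P -> t \in sd s ->
  {in s, forall x, P x} -> {in t, forall x, P x}.
Proof.
move=> bP; have [n] := ubnP (size s); elim: n s t => // n IH [|x s] t s_n.
  by rewrite inE => /eqP ->.
rewrite sd_cons => /mapP[u /flatten_mapP[v vs uv] ->] Ps y.
rewrite inE => /predU1P[->|]; first exact: bP.
apply: (IH v) => // [|z /(faces_sub vs)]; last exact: Ps.
by rewrite -ltnS -(size_faces vs).
Qed.

Lemma barycenter_sub s c : s != [::] ->
  barycenter s - c = (size s)%:R^-1 *: \sum_(x <- s) (x - c).
Proof.
move=> s0; rewrite sumrB big_const_seq count_predT iter_addr_0 scalerBr.
by rewrite -[c *+ _]scaler_nat scalerA mulVf ?scale1r // pnatr_eq0 size_eq0.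
Qed.

Lemma barycentric_ball c r : barycentric (fun x => `|x - c| <= r).
Proof.
move=> s s0 sr; rewrite barycenter_sub // normrZ normfV normr_nat.
rewrite ler_pdivrMl ?ltr0n ?lt0n ?size_eq0 //.
apply: le_trans (ler_norm_sum _ _ _) _.
rewrite mulr_natl -[in leRHS](count_predT s) -iter_addr_0 -big_const_seq.
by rewrite [leLHS]big_seq [leRHS]big_seq; apply: ler_sum => x; exact: sr.
Qed.

Definition diam_le s (r : R) := {in s &, forall x y, `|x - y| <= r}.

(** Among the [size s] differences being averaged, the one of [x] with itself is 0. *)
Lemma barycenter_dist s x r : x \in s -> diam_le s r ->
  `|barycenter s - x| <= (size s).-1%:R / (size s)%:R * r.
Proof.
move=> xs sr; have s0 : s != [::] by case: s xs {sr}.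
rewrite barycenter_sub // normrZ normfV normr_nat [_ / _]mulrC -mulrA.
rewrite ler_pM2l ?invr_gt0 ?ltr0n ?lt0n ?size_eq0 //.
rewrite (big_rem x) //= subrr add0r; apply: le_trans (ler_norm_sum _ _ _) _.
rewrite -(size_rem xs) mulr_natl -[in leRHS](count_predT (rem x s)).
rewrite -iter_addr_0 -big_const_seq [leLHS]big_seq [leRHS]big_seq.
by apply: ler_sum => y /mem_rem ys; exact: sr.
Qed.

Lemma ler_predn_ratio (m n : nat) : (m <= n.+1)%N ->
  (m.-1%:R / m%:R : R) <= n%:R / n.+1%:R.
Proof.
case: m => [|m] mn; first by rewrite mul0r divr_ge0.
rewrite ler_pdivrMr ?ltr0Sn // mulrAC ler_pdivlMr ?ltr0Sn //.
by rewrite -!natrM ler_nat /= !mulnS; rewrite mulnC leq_add2r.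
Qed.

(** Two vertices coming from a proper face are handled by induction. For the new barycenter [b], the
    ball around [b] of the claimed radius contains the vertices of the face and is convex, hence
    contains those of its subdivision. *)
Lemma sd_diam n s t r : (size s <= n.+1)%N -> 0 <= r -> t \in sd s ->
  diam_le s r -> diam_le t (n%:R / n.+1%:R * r).
Proof.
move=> + r0; have [m] := ubnP (size s); elim: m s t => // m IH [|x s] t s_m s_n.
  by rewrite inE => /eqP -> _.
rewrite sd_cons => /mapP[u /flatten_mapP[v vs uv] ->] sr.
have vm : (size v < m)%N by rewrite -ltnS -(size_faces vs).
have vn : (size v <= n.+1)%N.
  by apply: leq_trans (ltnW _) s_n; rewrite (size_faces vs).
have v_r : diam_le v r by move=> y z /(faces_sub vs) ? /(faces_sub vs); exact: sr.
have u_r := IH v u vm vn uv v_r.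
set b := barycenter _.
have ub y : y \in u -> `|y - b| <= n%:R / n.+1%:R * r.
  have := sd_barycentric (barycentric_ball (c := b) (r := n%:R / n.+1%:R * r)) uv.
  apply => z /(faces_sub vs) zs; rewrite distrC.
  apply: le_trans (barycenter_dist zs sr) _.
  by rewrite ler_wpM2r // ler_predn_ratio.
move=> y z; rewrite !inE => /predU1P[->|yu] /predU1P[->|zu].
- by rewrite subrr normr0 mulr_ge0 // divr_ge0.
- by rewrite distrC ub.
- exact: ub.
- exact: u_r.
Qed.

Lemma parity_suspension x C phi :
  parity (map (cons x) (C ++ map antipode C)) (cobd phi) =
  (parity C phi (+) parity C (cobd (phi \o cons x))) (+)
  (parity C (phi \o antipode) (+) parity C (cobd ((phi \o cons x) \o antipode))).
Proof.
rewrite parity_map parity_cat [X in _ (+) X]parity_map.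
congr addb; rewrite -parity_add; apply: eq_parity => s; rewrite /= cobd_cons //.
by rewrite cobd_antipode.
Qed.

(** * Triangulated hemispheres and their boundaries *)

Section Sphere.
Variable e : nat -> V.

(** Half of the boundary of a cross-polytope: the cone with apex [e k] over the whole equatorial
    sphere, itself a hemisphere together with its antipode. *)
Fixpoint hemisphere k : seq (seq V) :=
  if k is k'.+1
  then map (cons (e k)) (hemisphere k' ++ map antipode (hemisphere k'))
  else [:: [:: e 0]].

Definition subdivided_hemisphere N k :=
  iter N (fun C => flatten (map sd C)) (hemisphere k).

(** The boundary is the equatorial sphere. A cone over a chain has as boundary that chain plus the
    cone over its boundary; here the last term vanishes, because the two halves of the equator have
    the same boundary by induction. *)
Lemma parity_hemisphere_cobd k phi :
  parity (hemisphere k.+1) (cobd phi) =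
  parity (hemisphere k) (fun s => phi s (+) phi (antipode s)).
Proof.
elim: k phi => [|k IH] phi.
  rewrite /= !parity_cons !parity_nil /cobd /= !(parity_cons, parity_nil) /=.
  by rewrite !addbF; do 3 case: (phi [:: _]).
rewrite [LHS]parity_suspension; set psi := phi \o cons (e k.+2).
rewrite !IH !parity_add.
rewrite [X in _ (+) (_ (+) (_ (+) X))](@eq_parity _ _ _ psi); last first.
  by move=> s; rewrite /= antipodeK.
set a := parity _ phi; set b := parity _ psi; set a' := parity _ (fun _ => phi _).
set b' := parity _ _.
by case: a; case: b; case: a'; case: b'.
Qed.

(** Subdivision is a chain map and commutes with the antipode, so the boundary formula survives each
    iteration. *)
Lemma parity_subdivided_hemisphere_cobd N k phi :
  parity (subdivided_hemisphere N k.+1) (cobd phi) =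
  parity (subdivided_hemisphere N k) (fun s => phi s (+) phi (antipode s)).
Proof.
rewrite /subdivided_hemisphere.
elim: N phi => [|N IH] phi /=; first exact: parity_hemisphere_cobd.
rewrite !parity_flatten; under eq_parity do rewrite parity_sd_cobd.
rewrite IH; apply: eq_parity => s.
by rewrite sd_antipode parity_map -parity_add.
Qed.

Lemma size_subdivided_hemisphere N k s :
  s \in subdivided_hemisphere N k -> size s = k.+1.
Proof.
elim: N s => [|N IH] s; last by move=> /flatten_mapP[t /IH <- /size_sd].
elim: k s => [|k IH] s /=; first by rewrite inE => /eqP ->.
move=> /mapP[t + ->]; rewrite mem_cat => /orP[/IH|/mapP[u /IH + ->]] /=.
  by move=> ->.
by rewrite size_map => ->.
Qed.

(** Each induction step passes to the boundary sphere and folds it onto a hemisphere one dimension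
    lower; oddness is used only there, hence the bound [l < k]. *)
Lemma parity_alternates (I : eqType) (g : I -> V -> bool) N k (r : seq I) :
  size r = k ->
  (forall i l s x, i \in r -> (l < k)%N -> s \in subdivided_hemisphere N l ->
     x \in s -> g i (- x) = ~~ g i x) ->
  parity (subdivided_hemisphere N k) (alternates g r).
Proof.
elim: k r => [|k IH] [|i r] //= => [_ _|[r_k] g_odd].
  (* A single vertex is its own barycenter, so subdividing it changes nothing. *)
  rewrite /subdivided_hemisphere (_ : iter _ _ _ = [:: [:: e 0]]).
    by rewrite parity_cons parity_nil.
  elim: N => //= N ->; rewrite /= /sd /= /barycenter big_seq1 /= invr1 scale1r.
  by [].
suff -> : parity (subdivided_hemisphere N k.+1) (alternates g (i :: r)) =
    parity (subdivided_hemisphere N k) (alternates g r).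
  apply: IH => // j l s x jr lk sS xs.
  by apply: (g_odd j l s) => //; [rewrite inE jr orbT|rewrite ltnW].
transitivity (parity (subdivided_hemisphere N k.+1)
   (cobd (fun t => head false (map (g i) t) && alternates g r t))).
  apply: eq_big_seq => s /size_subdivided_hemisphere s_k.
  by rewrite cobd_alternates // s_k r_k.
rewrite parity_subdivided_hemisphere_cobd; apply: eq_big_seq => s sS.
(* Under the antipode both signs in each factor flip, so the product is invariant, whereas the
   leading value of [g i] flips; the two summands thus add up to [alternates g r s]. *)
have alt_anti : alternates g r (antipode s) = alternates g r s.
  have : {in r & s, forall j x, g j (- x) = ~~ g j x}.
    by move=> j x jr xs; apply: (g_odd j k s); rewrite ?inE ?jr ?orbT.
  elim: (r) (s) => [|j r' IHr] [|x [|y t]] //= H.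
  rewrite -[- y :: _]/(antipode (y :: t)) IHr => [|h z hr zt];
    last by apply: H; rewrite inE ?hr ?zt orbT.
  rewrite !H ?inE ?eqxx ?orbT //.
  by case: (g j x); case: (g j y).
have := size_subdivided_hemisphere sS.
case: s sS alt_anti => // x s sS /= -> _.
rewrite (g_odd i k (x :: s)) ?inE ?eqxx //.
by case: (g i x); case: alternates.
Qed.

Lemma mesh_subdivided_hemisphere N k r s : 0 <= r ->
  (forall s, s \in hemisphere k -> diam_le s r) ->
  s \in subdivided_hemisphere N k -> diam_le s ((k%:R / k.+1%:R) ^+ N * r).
Proof.
move=> r0 Hr; elim: N s => [|N IH] s; first by rewrite mul1r; exact: Hr.
move=> /flatten_mapP[t tS st]; rewrite exprS -mulrA.
apply: sd_diam st (IH t tS); last by rewrite mulr_ge0 ?exprn_ge0 ?divr_ge0.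
by rewrite (size_subdivided_hemisphere tS).
Qed.

(** Expresses that [s] lies in the convex hull of an original simplex [t]. *)
Lemma subdivided_hemisphere_barycentric N k s :
  s \in subdivided_hemisphere N k -> exists2 t, t \in hemisphere k &
  forall P, barycentric P -> {in t, forall x, P x} -> {in s, forall x, P x}.
Proof.
elim: N s => [|N IH] s; first by exists s.
move=> /flatten_mapP[t /IH[u uS ut] st]; exists u => // P bP Pu.
exact: (sd_barycentric bP st (ut P bP Pu)).
Qed.

End Sphere.

End Subdivision.

Lemma ler_coord_norm (R : realType) n (v : 'rV[R]_n) i : `|v 0 i| <= `|v|.
Proof.
by rewrite [leRHS]/Num.norm /= mx_normrE; apply/bigmax_geP; right => /=; exists (0, i).
Qed.

(** * The Borsuk-Ulam theorem *)

Section BorsukUlam.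
Variables (R : realType) (d : nat).
Notation V := ('rV[R]_d.+1).
Implicit Types (a u v : V).

Let e (k : nat) : V := delta_mx 0 (inord k).

(* Stands for a face of the cross-polytope: a convex set avoiding 0. *)
Let on_face (a v : V) := `|v| <= 1 /\ \sum_i a 0 i * v 0 i = 1.

Lemma on_face_barycentric a : barycentric (on_face a).
Proof.
move=> s s0 sP; split.
  have := @barycentric_ball R _ (0 : V) 1 s s0; rewrite subr0; apply=> x xs.
  by rewrite subr0; case: (sP x xs).
transitivity ((size s)%:R^-1 * \sum_(x <- s) \sum_i a 0 i * x 0 i).
  rewrite exchange_big mulr_sumr; apply: eq_bigr => i _.
  by rewrite -mulr_sumr mxE summxE mulrCA.
rewrite (eq_big_seq (fun=> 1)) => [|x /sP[]//].
by rewrite big_const_seq count_predT iter_addr_0 mulVf // pnatr_eq0 size_eq0.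
Qed.

(** The witness [a] is the sum of the vertices of [s], which are signed basis vectors on distinct
    axes. The induction also records that coordinates beyond [k] vanish, so that adding the next
    apex does not disturb the earlier values. *)
Lemma hemisphere_on_face k s : (k <= d)%N -> s \in hemisphere e k ->
  exists2 a : V, (forall i, `|a 0 i| <= 1) & {in s, forall v, on_face a v}.
Proof.
move=> kd sH; suff [a [a1 _ av]] : exists a : V, [/\ forall i, `|a 0 i| <= 1,
    forall i : 'I_d.+1, (k < i)%N -> a 0 i = 0 &
    {in s, forall v, on_face a v /\ forall i : 'I_d.+1, (k < i)%N -> v 0 i = 0}].
  by exists a => // v /av[].
have norm_e j : `|e j| <= 1.
  rewrite [leLHS]/Num.norm /= mx_normrE; apply/bigmax_leP; split=> // -[i l] _ /=.
  by rewrite mxE; case: andb; rewrite ?normr1 ?normr0.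
have e0 j l (i : 'I_d.+1) : (j <= l <= d)%N -> (l < i)%N -> e j 0 i = 0.
  move=> /andP[jl ld] li; rewrite mxE eqxx /= -val_eqE /= inordK; last first.
    by rewrite ltnS (leq_trans jl).
  by rewrite gtn_eqF // (leq_ltn_trans jl).
elim: k s kd sH => [|k IH] s kd /=.
  rewrite inE => /eqP ->; exists (e 0); split.
  - by move=> i; apply: le_trans (ler_coord_norm _ _) _.
  - by move=> i; apply: e0.
  - move=> v; rewrite inE => /eqP ->; split; last by move=> i; apply: e0.
    split=> //; rewrite (bigD1 (inord 0)) //= big1 ?addr0.
      by rewrite mxE !eqxx mulr1.
    by move=> i /negPf i0; rewrite !mxE i0 andbF mulr0.
have kd' := ltnW kd.
move=> /mapP[t tH ->].
have [a [a1 a0 at_]] : exists a : V, [/\ forall i, `|a 0 i| <= 1,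
    forall i : 'I_d.+1, (k < i)%N -> a 0 i = 0 &
    {in t, forall v, on_face a v /\ forall i : 'I_d.+1, (k < i)%N -> v 0 i = 0}].
  move: tH; rewrite mem_cat => /orP[/(IH _ kd')//|/mapP[u /(IH _ kd')[a [a1 a0 au]] ->]].
  exists (- a); split.
  - by move=> i; rewrite mxE normrN.
  - by move=> i /a0; rewrite mxE => ->; rewrite oppr0.
  - move=> _ /mapP[v /au[[v1 va] v0] ->]; split; last first.
      by move=> i /v0; rewrite mxE => ->; rewrite oppr0.
    split; first by rewrite normrN.
    by rewrite -[RHS]va; apply: eq_bigr => i _; rewrite !mxE mulrNN.
have ek (i : 'I_d.+1) : e k.+1 0 i = (i == k.+1 :> nat)%:R.
  by rewrite mxE eqxx /= -val_eqE /= inordK.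
exists (a + e k.+1); split.
- move=> i; rewrite mxE ek; case: eqP => [ik|_]; last by rewrite addr0.
  by rewrite a0 ?ik // add0r normr1.
- move=> i ki; rewrite mxE a0 ?(ltnW ki) // add0r ek.
  by rewrite gtn_eqF.
- move=> v; rewrite inE => /predU1P[->|vt].
    split; last by move=> i ki; rewrite ek gtn_eqF.
    split=> //; rewrite (bigD1 (inord k.+1)) //= big1 ?addr0.
      by rewrite !mxE a0 ?inordK // add0r !eqxx mulr1.
    by move=> i /negPf i0; rewrite !mxE i0 andbF mulr0.
  have [[v1 va] v0] := at_ _ vt; split; last by move=> i ki; rewrite v0 // ltnW.
  split=> //; rewrite -[RHS]va; apply: eq_bigr => i _; rewrite mxE mulrDl ek.
  by case: eqP => [ik|_]; [rewrite v0 ?ik // !mulr0 addr0|rewrite mul0r addr0].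
Qed.

(** A compact set avoiding 0 that contains every face: in the sup norm, a functional with [d.+1]
    coefficients bounded by 1 can take the value 1 only at norm at least [d.+1%:R^-1]. *)
Let shell : set V := [set v | `|v| <= 1 /\ d.+1%:R^-1 <= `|v|].

Lemma on_face_shell a v : (forall i, `|a 0 i| <= 1) -> on_face a v -> shell v.
Proof.
move=> a1 [v1 va]; split => //.
suff : `|\sum_i a 0 i * v 0 i| <= d.+1%:R * `|v|.
  by rewrite va normr1 -ler_pdivrMl ?ltr0Sn // mulr1.
apply: le_trans (ler_norm_sum _ _ _) _.
apply: (@le_trans _ _ (\sum_(i < d.+1) `|v|)); last first.
  by rewrite sumr_const card_ord mulr_natl.
apply: ler_sum => i _; rewrite normrM -[leRHS]mul1r.
by rewrite ler_pM // ler_coord_norm.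
Qed.

Lemma shell_neq0 v : shell v -> v != 0.
Proof. by move=> [_]; apply: contraTneq => ->; rewrite normr0 invr_le0 lern0. Qed.

Lemma shell_compact : compact shell.
Proof.
apply: bounded_closed_compact.
  exists 1; split=> // M M1 v [v1 _] /=; exact: le_trans v1 (ltW M1).
have norm_cont : continuous (fun v : V => `|v|).
  by move=> v; exact: (@norm_continuous R V v).
apply: closedI.
  by apply: (preimage_closed (f := fun v : V => `|v|) _ (@closed_le R 1)) => v _.
by apply: (preimage_closed (f := fun v : V => `|v|) _ (@closed_ge R _)) => v _.
Qed.

(* An arbitrary odd sign function, used where a coordinate of the map is 0. *)
Let tie v : bool := if [pick i | v 0 i != 0] is Some i then 0 < v 0 i else false.

Lemma tie_odd v : v != 0 -> tie (- v) = ~~ tie v.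
Proof.
move=> v0; rewrite /tie.
rewrite (eq_pick (Q := fun i => v 0 i != 0)); last first.
  by move=> i; rewrite mxE oppr_eq0.
case: pickP => [i vi|v_0]; first by rewrite mxE oppr_gt0 -leNgt le_eqVlt (negPf vi).
case/eqP: v0; apply/rowP => i; rewrite mxE; apply/eqP.
by have := v_0 i; case: eqP.
Qed.

Lemma geometric_lt (q c eps : R) : 0 <= q < 1 -> 0 < eps ->
  exists N, q ^+ N * c <= eps.
Proof.
move=> /andP[q0 q1] eps0.
have : q ^+ N * c @[N --> \oo] --> 0 * c.
  by apply: cvgM; [apply: cvg_expr; rewrite ger0_norm|exact: cvg_cst].
rewrite mul0r => /cvgr_lt /(_ _ eps0)/= [N _ /(_ N)] H.
by exists N; apply: ltW; apply: H => /=.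
Qed.

Lemma alternates_change (I : eqType) (g : I -> V -> bool) r s i :
  alternates g r s -> i \in r ->
  exists x y, [/\ x \in s, y \in s & g i x != g i y].
Proof.
elim: r s => [|j r IH] [|x [|y s]] //= /andP[gj alt]; rewrite inE.
move=> /predU1P[->|ir].
  by exists x, y; rewrite !inE !eqxx orbT; split=> //; rewrite -[_ == _]/(eqb _ _) negb_eqb.
have [z [t [zs ts gzt]]] := IH _ alt ir.
by exists z, t; split; rewrite // inE ?zs ?ts orbT.
Qed.

Theorem borsuk_ulam (I : eqType) (r : seq I) (f : I -> V -> R) : size r = d ->
  (forall i v, i \in r -> v != 0 -> {for v, continuous (f i)}) ->
  (forall i v, i \in r -> v != 0 -> f i (- v) = - f i v) ->
  exists2 v, v != 0 & {in r, forall i, f i v = 0}.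
Proof.
move=> r_d f_cont f_odd; apply: contrapT => no_zero.
(* A Lebesgue number: without a common zero, compactness gives one radius within which some [f i]
   keeps a strict sign around each point of the shell. *)
have [eps eps0 f_sgn] : exists2 eps : R, 0 < eps & forall x, shell x ->
    exists2 i, i \in r & forall y, `|x - y| <= eps -> 0 < f i x * f i y.
  have near_sgn v : shell v -> \forall x \near v & eps \near (0:R)^'+,
      exists2 i, i \in r & forall y, `|x - y| <= eps -> 0 < f i x * f i y.
    move=> /shell_neq0 v0.
    have [i ir fv0] : exists2 i, i \in r & f i v != 0.
      apply: contrapT => fv0; apply: no_zero; exists v => // i ir.
      by apply/eqP/negPn/negP => fiv; apply: fv0; exists i.
    have fv2 : 0 < f i v * f i v by rewrite -expr2 exprn_even_gt0.
    have near_v : \forall x \near v, 0 < f i v * f i x.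
      have fv : f i x @[x --> v] --> f i v := f_cont i v ir v0.
      have : (f i v * f i x) @[x --> v] --> f i v * f i v.
        exact: (cvgM (cvg_cst (f i v)) fv).
      by move=> /cvgr_gt; apply.
    have [del /= del0 ball_v] := (nbhs_ballP _ _).1 near_v.
    (* One half of the radius is spent from [v] to [x], the other from [x] to [y]. *)
    have del20 : 0 < del / 2 by rewrite divr_gt0.
    exists (ball v (del / 2), [set eps | 0 < eps < del / 2]).
      split => /=; first exact: nbhsx_ballx.
      by near=> t; apply/andP; split; near: t; [exact: nbhs_right_gt|exact: nbhs_right_lt].
    move=> [x eps] /= [vx /andP[eps0 eps_del]]; exists i => // y xy.
    have fx : 0 < f i v * f i x.
      by apply: ball_v; apply: le_ball vx; rewrite ler_pdivrMr // ler_peMr ?ler1n // ltW.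
    have fy : 0 < f i v * f i y.
      apply: ball_v; rewrite [del]splitr; apply: ball_triangle vx _.
      by rewrite -ball_normE /=; apply: le_lt_trans eps_del.
    by rewrite -(pmulr_rgt0 _ fv2) mulrACA mulr_gt0.
  have := (compact_near_coveringP shell).1 shell_compact _ _ _ _ near_sgn.
  move=> H.
  have [eps [eps0 Heps]] := filter_ex (filterI (nbhs_right_gt (0:R)) (H _)).
  by exists eps => // x /Heps.
pose g i v := if f i v == 0 then tie v else 0 < f i v.
have g_odd i v : i \in r -> v != 0 -> g i (- v) = ~~ g i v.
  move=> ir v0; rewrite /g f_odd // oppr_eq0; case: eqVneq => [_|fv].
    exact: tie_odd.
  by rewrite oppr_gt0 -leNgt le_eqVlt (negPf fv).
(* The 2 bounds the diameter of the initial simplices, whose vertices have norm at most 1. *)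
have [N N_eps] : exists N, (d%:R / d.+1%:R) ^+ N * 2 <= eps.
  apply: geometric_lt eps0.
  by rewrite divr_ge0 //= ltr_pdivrMr ?ltr0Sn // mul1r ltr_nat.
have in_shell k s : (k <= d)%N -> s \in subdivided_hemisphere e N k ->
    {in s, forall v, shell v}.
  move=> kd /subdivided_hemisphere_barycentric[t tH ts] v vs.
  have [a a1 ta] := hemisphere_on_face kd tH.
  exact: on_face_shell a1 (ts _ (@on_face_barycentric a) ta v vs).
have par : parity (subdivided_hemisphere e N d) (alternates g r).
  apply: parity_alternates => // i l s x ir ld sS xs.
  by apply: g_odd ir _; apply: shell_neq0; apply: in_shell sS _ xs; exact: ltnW.
have [s sS s_alt] : exists2 s, s \in subdivided_hemisphere e N d & alternates g r s.
  apply: contrapT => no_s; move: par; rewrite /parity big_seq big1 // => s sS.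
  by apply/negP => s_alt; apply: no_s; exists s.
have s_eps : diam_le s eps.
  have := @mesh_subdivided_hemisphere R V e N d 2 s (ler0n _ 2).
  move=> /(_ _ sS) mesh x y xs ys; apply: le_trans (mesh _ x y xs ys) N_eps.
  move=> t tH u v ut vt.
  have [a _ ta] := hemisphere_on_face (leqnn d) tH.
  have [[u1 _] [v1 _]] := (ta u ut, ta v vt).
  by apply: le_trans (ler_normB _ _) _; rewrite -[2]/(1 + 1) lerD.
have := size_subdivided_hemisphere sS.
case: s sS s_alt s_eps => // x s sS s_alt s_eps _.
have xs : x \in x :: s by rewrite mem_head.
have [i ir fi] := f_sgn x (in_shell d _ (leqnn d) sS x xs).
have [y [z [ys zs]]] := alternates_change s_alt ir.
(* Both [f i y] and [f i z] have the strict sign of [f i x], so [tie] is not consulted and [g i]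
   cannot differ at [y] and [z]. *)
have := mulr_gt0 (fi y (s_eps x y xs ys)) (fi z (s_eps x z xs zs)).
rewrite mulrACA pmulr_rgt0; last first.
  have := fi y (s_eps x y xs ys); rewrite -expr2 exprn_even_gt0 //=.
  by apply: contraTneq => ->; rewrite mul0r ltxx.
rewrite /g; have [->|fy0] := eqVneq (f i y) 0; first by rewrite mul0r ltxx.
have [->|fz0] := eqVneq (f i z) 0; first by rewrite mulr0 ltxx.
case: (ltP 0 (f i y)) => fy; case: (ltP 0 (f i z)) => fz //=.
  by rewrite pmulr_rgt0 // ltNge fz.
by rewrite pmulr_lgt0 // ltNge fy.
Unshelve. all: by end_near.
Qed.

End BorsukUlam.

(** * Antipodal zeros prescribed by a partition of the indices *)

Lemma for_continuous_opp (R : realType) n (f : 'rV[R]_n -> R) (v : 'rV[R]_n) :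
  {for - v, continuous f} -> {for v, continuous (fun w : 'rV[R]_n => f (- w))}.
Proof.
exact: (@continuous_comp _ _ _ (@GRing.opp 'rV[R]_n) f v
  (@opp_continuous 'rV[R]_n v)).
Qed.

Theorem antipodal_partition (R : realType) d (g : 'I_d.+2 -> 'rV[R]_d.+1 -> R) :
  (forall i v, v != 0 -> {for v, continuous (g i)}) ->
  (forall i v, v != 0 -> 0 <= g i v) ->
  (forall v, v != 0 -> exists i, g i v = 0) ->
  (forall i v, v != 0 -> g i v = 0 -> g i (- v) <> 0) ->
  forall F G : set 'I_d.+2, F !=set0 -> G !=set0 -> F `|` G = setT ->
  F `&` G = set0 ->
  exists2 v, v != 0 & (forall i, F i -> g i v = 0) /\
                      (forall i, G i -> g i (- v) = 0).
Proof.
move=> g_cont g_ge0 g_zero g_anti F G [i0 Fi0] [j0 Gj0] FG disjFG.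
have FNG i : F i -> G i -> False.
  by move=> Fi Gi; suff : set0 i by []; rewrite -disjFG.
have FoG i : F i \/ G i by suff : (F `|` G) i by []; rewrite FG.
pose K i v := (g i (- v) - g i v) / (g i (- v) + g i v).
have den_gt0 i v : v != 0 -> 0 < g i (- v) + g i v.
  move=> v0; have Nv0 : - v != 0 by rewrite oppr_eq0.
  rewrite lt_neqAle addr_ge0 ?g_ge0 // andbT eq_sym paddr_eq0 ?g_ge0 //.
  by apply/andP => -[/eqP gN /eqP gv]; exact: g_anti gv gN.
have K1 i v : v != 0 -> K i v = 1 <-> g i v = 0.
  move=> v0; have D := den_gt0 i v v0; split=> [|gv]; last first.
    by rewrite /K gv in D *; rewrite subr0 addr0 divff // -[g _ _]addr0 gt_eqF.
  move/divr1_eq; lra.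
have KN i v : K i (- v) = - K i v.
  by rewrite /K opprK -mulNr opprB [X in _ / X = _]addrC.
have K_cont i v : v != 0 -> {for v, continuous (K i)}.
  move=> v0; have gv := g_cont i v v0.
  have Nv0 : - v != 0 by rewrite oppr_eq0.
  have gNv := for_continuous_opp (g_cont i _ Nv0).
  have := den_gt0 i v v0; rewrite lt_def => /andP[D0 _].
  exact: (cvgM (cvgB gNv gv) (cvgV D0 (cvgD gNv gv))).
(* One representative per class is dropped from the [d.+2] indices, leaving the [d] differences that
   Borsuk-Ulam allows. *)
pose base i := if `[< F i >] then i0 else j0.
pose f i v := K i v - K (base i) v.
pose r := enum ([set~ i0] :\ j0)%SET.
have r_d : size r = d.
  have i0j0 : j0 != i0 by apply/eqP => e; apply: (FNG i0) => //; rewrite -e.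
  apply: succn_inj; rewrite -cardE.
  have := cardsD1 j0 [set~ i0]%SET; rewrite cardsC1 card_ord !inE i0j0 /=.
  by move=> e; exact: (esym e).
have [u u0 fu] : exists2 u, u != 0 & {in r, forall i, f i u = 0}.
  apply: borsuk_ulam r_d _ _ => i v _ v0.
    exact: (cvgB (K_cont i v v0) (K_cont (base i) v v0)).
  by rewrite /f !KN opprD.
have Kbase i : K i u = K (base i) u.
  have [ir|] := boolP (i \in r).
    by apply/eqP; rewrite -subr_eq0; apply/eqP; exact: fu.
  rewrite mem_enum !inE negb_and !negbK => /orP[/eqP ->|/eqP ->]; rewrite /base.
    by case: asboolP => // /FNG /(_ Gj0).
  by case: asboolP.
have KF i : F i -> K i u = K i0 u by move=> Fi; rewrite Kbase /base asboolT.
have KG i : G i -> K i u = K j0 u.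
  by move=> Gi; rewrite Kbase /base asboolF // => /FNG /(_ Gi).
have Nu0 : - u != 0 by rewrite oppr_eq0.
(* Some coordinate of [K] at [u] is 1 and some is -1; they lie in different classes, and the choice
   between [u] and [- u] depends on which class has the value 1. *)
have [i /(K1 _ _ u0) Ki] := g_zero u u0.
have [j /(K1 _ _ Nu0)] := g_zero (- u) Nu0; rewrite KN => Kj.
have [Fi|Gi] := FoG i; have [Fj|Gj] := FoG j.
- by move: Kj; rewrite (KF j Fj) -(KF i Fi) Ki => /eqP; rewrite eqNr oner_eq0.
- exists u => //; split=> k kP; first by apply/K1; rewrite // (KF k) // -(KF i).
  by apply/K1; rewrite // KN (KG k) // -(KG j).
- exists (- u) => //; split=> k kP.
    by apply/K1; rewrite // KN (KF k) // -(KF j).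
  by rewrite opprK; apply/K1; rewrite // (KG k) // -(KG i).
- by move: Kj; rewrite (KG j Gj) -(KG i Gi) Ki => /eqP; rewrite eqNr oner_eq0.
Qed.

(** * Segments over an oriented line *)

Lemma segmentC (R : realType) n (p q : 'rV[R]_n) : segment p q = segment q p.
Proof.
suff sub : forall p q : 'rV[R]_n, segment p q `<=` segment q p.
  by apply/seteqP; split; exact: sub.
move=> {}p {}q x [t /=]; rewrite in_itv /= => /andP[t0 t1] <-; exists (1 - t).
  by rewrite /= in_itv /=; apply/andP; split; lra.
by rewrite opprB addrCA subrr addr0 addrC.
Qed.

Lemma segment_scale (R : realType) n (v : 'rV[R]_n) (s t : R) : s <= t ->
  segment (s *: v) (t *: v) = [set c *: v | c in `[s, t]%classic].
Proof.
move=> st; apply/seteqP; split=> x [c /=]; rewrite in_itv /= => /andP[c0 c1] <-.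
  exists ((1 - c) * s + c * t); last by rewrite !scalerA scalerDl.
  by rewrite /= in_itv /=; apply/andP; split; nra.
have [e|ts] := eqVneq s t.
  exists 0; first by rewrite /= in_itv /= lexx ler01.
  rewrite subr0 scale1r scale0r addr0; congr (_ *: _); apply/eqP.
  by rewrite eq_le c0 e c1.
have st0 : 0 < t - s by rewrite subr_gt0 lt_neqAle ts.
exists ((c - s) / (t - s)).
  by rewrite /= in_itv /= divr_ge0 ?ler_pdivrMr //; lra.
rewrite !scalerA -scalerDl; congr (_ *: _).
by field; rewrite gt_eqF.
Qed.

Section SegmentFamily.
Context (R : realType) (n : nat) (S : grassmannian1 R n -> set 'rV[R]_n).
Hypothesis S_line : forall L x, S L x -> x \in sval L.
Hypothesis S_segment : forall L, is_segment (S L).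
Hypothesis S_cont : hausdorff_continuous S.
Implicit Types (v w : 'rV[R]_n) (L : grassmannian1 R n).

(* Coordinates with respect to [v] of the points of the segment over <[v]>; the
   vector [v] orients its line. *)
Definition slice v : set R :=
  [set c | exists2 L, sval L = <[v]>%VS & S L (c *: v)].

Definition right_end v : R := sup (slice v).
(** Reversing the orientation negates coordinates and swaps the ends, so results on right ends
    transfer to left ends. *)
Definition left_end v : R := - right_end (- v).

Lemma line_exists v : v != 0 -> exists L : grassmannian1 R n, sval L = <[v]>%VS.
Proof.
move=> v0; have dv : \dim <[v]>%VS == 1%N by rewrite dim_vline v0.
by exists (exist _ <[v]>%VS dv).
Qed.

Lemma line_unique (L M : grassmannian1 R n) (U : {vspace 'rV[R]_n}) :
  sval L = U -> sval M = U -> L = M.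
Proof. by move=> LU MU; apply: val_inj; rewrite /= LU MU. Qed.

Lemma vlineN v : <[- v]>%VS = <[v]>%VS.
Proof.
apply: subv_anti; rewrite -!memvE memvN memv_line /=.
by rewrite -[X in X \in _]opprK memvN memv_line.
Qed.

Lemma right_endE v L (a b : R) : v != 0 -> sval L = <[v]>%VS -> a <= b ->
  S L = [set c *: v | c in `[a, b]%classic] -> right_end v = b.
Proof.
move=> v0 Lv ab SL; rewrite /right_end.
suff -> : slice v = `[a, b]%classic by rewrite sup_itvcc.
apply/seteqP; split=> c; last by move=> cab; exists L => //; rewrite SL; exists c.
move=> [M Mv]; rewrite (line_unique Mv Lv) SL => -[c' c'ab].
by move/eqP; rewrite -subr_eq0 -scalerBl scaler_eq0 (negPf v0) orbF subr_eq0
  => /eqP <-.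
Qed.

Lemma slice_ends v L : v != 0 -> sval L = <[v]>%VS ->
  left_end v <= right_end v /\
  S L = [set c *: v | c in `[left_end v, right_end v]%classic].
Proof.
move=> v0 Lv; have [p [q SL]] := S_segment L.
have segP (x y : 'rV[R]_n) : segment x y x /\ segment x y y.
  split; [exists 0|exists 1]; rewrite /= ?in_itv /= ?lexx ?ler01 //.
    by rewrite subr0 scale1r scale0r addr0.
  by rewrite subrr scale1r scale0r add0r.
have : p \in sval L by apply: S_line; rewrite SL; case: (segP p q).
have : q \in sval L by apply: S_line; rewrite SL; case: (segP p q).
rewrite Lv => /vlineP[t qt] /vlineP[s ps].
have {p q ps qt SL segP} [a [b [ab SL]]] : exists a b : R, a <= b /\
    S L = [set c *: v | c in `[a, b]%classic].
  rewrite SL ps qt; have [st|ts] := leP s t.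
    by exists s, t; split=> //; exact: segment_scale.
  by exists t, s; split; [exact: ltW|rewrite segmentC segment_scale // ltW].
have -> : right_end v = b by exact: right_endE Lv ab SL.
suff -> : left_end v = a by [].
rewrite /left_end (@right_endE _ L (- b) (- a)) ?opprK ?oppr_eq0 ?vlineN ?lerN2 //.
rewrite SL; apply/seteqP; split=> x [c /=]; rewrite in_itv /= => /andP[ac cb] <-.
  by exists (- c); rewrite /= ?in_itv /= ?lerN2 ?ac ?cb // scaleNr scalerN opprK.
exists (- c); last by rewrite scaleNr scalerN.
by rewrite /= in_itv /= [a <= _]lerNr [_ <= b]lerNl ac cb.
Qed.

Lemma left_endN v : left_end (- v) = - right_end v.
Proof. by rewrite /left_end opprK. Qed.

Lemma right_end_scale v (c : R) : v != 0 -> 0 < c ->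
  right_end (c *: v) = right_end v / c.
Proof.
move=> v0 c0; have [L Lv] := line_exists v0; have [le_lr SL] := slice_ends v0 Lv.
have cN0 : c != 0 by rewrite gt_eqF.
have cv0 : c *: v != 0 by rewrite scaler_eq0 negb_or cN0.
apply: (@right_endE _ L (left_end v / c)) => //.
- rewrite Lv; apply: subv_anti; rewrite -!memvE memvZ ?memv_line // andbT.
  by rewrite -[X in X \in _](scalerK cN0) memvZ ?memv_line.
- by rewrite ler_pM2r ?invr_gt0.
- rewrite SL; apply/seteqP; split=> x [t /=]; rewrite in_itv /= => /andP[tl tr] <-.
    exists (t / c); last by rewrite scalerA divfK.
    by rewrite /= in_itv /= !ler_pM2r ?invr_gt0 // tl.
  exists (t * c); last by rewrite scalerA.
  by rewrite /= in_itv /= -ler_pdivrMr // tl -ler_pdivlMr.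
Qed.

Lemma ler_euclidean_dist (x y : 'rV[R]_n) j :
  `|x 0 j - y 0 j| <= euclidean_dist x y.
Proof.
rewrite -sqrtr_sqr ler_wsqrtr // (bigD1 j) //= lerDl.
by apply: sumr_ge0 => i _; exact: sqr_ge0.
Qed.

Lemma hausdorff_dist_lt (A B : set 'rV[R]_n) (eps : R) :
  (hausdorff_dist A B < eps%:E)%E ->
  (forall x, A x -> exists2 y, B y & euclidean_dist x y < eps) /\
  (forall y, B y -> exists2 x, A x & euclidean_dist x y < eps).
Proof.
rewrite /hausdorff_dist gt_max => /andP[ltA ltB].
split=> [x Ax|y By].
  have /ereal_inf_lt[_ [y By <-]] : (ereal_inf
      [set (euclidean_dist x y)%:E | y in B] < eps%:E)%E.
    by apply: le_lt_trans ltA; apply: ereal_sup_ubound; exists x.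
  by rewrite lte_fin; exists y.
have /ereal_inf_lt[_ [x Ax <-]] : (ereal_inf
    [set (euclidean_dist x y)%:E | x in A] < eps%:E)%E.
  by apply: le_lt_trans ltB; apply: ereal_sup_ubound; exists y.
by rewrite lte_fin; exists x.
Qed.

(** By the quotient topology, an open neighbourhood of [L] pulls back to an open set of spanning
    vectors. *)
Lemma near_hausdorff v L (eps : R) : v != 0 -> sval L = <[v]>%VS -> 0 < eps ->
  \forall w \near v, forall M, sval M = <[w]>%VS ->
    (hausdorff_dist (S M) (S L) < eps%:E)%E.
Proof.
move=> v0 Lv eps0.
have near_L : \forall M \near L, (hausdorff_dist (S M) (S L) < eps%:E)%E.
  have nbhs0 : nbhs (0 : \bar R)%E [set x | (x < eps%:E)%E].
    by apply: open_nbhs_nbhs; split; [exact: open_ereal_lt_ereal|rewrite /= lte_fin].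
  exact: (S_cont L nbhs0).
have : nbhs L [set M | (hausdorff_dist (S M) (S L) < eps%:E)%E] by exact: near_L.
rewrite nbhsE => -[U [oU UL] Usub].
have oU' : open [set w : 'rV[R]_n | exists2 M, U M & sval M = <[w]>%VS] by exact: oU.
have : nbhs v [set w : 'rV[R]_n | exists2 M, U M & sval M = <[w]>%VS].
  by apply: open_nbhs_nbhs; split=> //; exists L.
apply: filterS => w [M UM Mw] M' M'w.
by rewrite (line_unique M'w Mw); exact: Usub.
Qed.

(** The linear form [phi] is positive near [v], so its maximum over the segment is attained at the
    right end. Hausdorff continuity makes this maximum continuous, and dividing by [phi w] recovers
    the coordinate. *)
Lemma right_end_continuous v : v != 0 -> {for v, continuous right_end}.
Proof.
move=> v0; have [L Lv] := line_exists v0; have [lr SL] := slice_ends v0 Lv.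
have [j vj0] : exists j, v 0 j != 0.
  apply: contrapT => vj0; case/eqP: v0; apply/rowP => j; rewrite mxE.
  by apply/eqP/negPn/negP => vj; apply: vj0; exists j.
pose phi (w : 'rV[R]_n) : R := v 0 j * w 0 j.
have phi_cont : phi w @[w --> v] --> phi v.
  have vj : w 0 j @[w --> v] --> v 0 j := @coord_continuous R 1 n 0 j v.
  exact: (cvgM (cvg_cst (v 0 j)) vj).
have phiv : 0 < phi v by rewrite /phi -expr2 exprn_even_gt0.
have phiZ c w : phi (c *: w) = c * phi w by rewrite /phi mxE mulrCA.
have vj_gt0 : 0 < `|v 0 j| by rewrite normr_gt0.
have phi_dist x y (e : R) : euclidean_dist x y < e / `|v 0 j| ->
    `|phi x - phi y| <= e.
  move=> xy; rewrite /phi -mulrBr normrM mulrC -ler_pdivlMr //.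
  exact: le_trans (ler_euclidean_dist _ _ _) (ltW xy).
have near_phi : \forall w \near v, 0 < phi w by move/cvgr_gt: phi_cont; apply.
have prod_cont : right_end w * phi w @[w --> v] --> right_end v * phi v.
  apply/(@cvgrPdist_le _ _ _ (nbhs v) _) => e e0.
  (* The form [phi] is Lipschitz with constant [|v 0 j|] for the Euclidean distance. *)
  have := near_hausdorff v0 Lv (divr_gt0 e0 vj_gt0).
  apply: filterS2 near_phi => w phiw near_w.
  have w0 : w != 0 by apply: contraTneq phiw => ->; rewrite /phi mxE mulr0 ltxx.
  have [M Mw] := line_exists w0; have [lrw SM] := slice_ends w0 Mw.
  have [MtoL LtoM] := hausdorff_dist_lt (near_w M Mw).
  (* Each right end is close to a point of the other segment, which cannot exceed that segment's
     maximum; the two directions give the two inequalities. *)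
  have [|y + /phi_dist] := MtoL (right_end w *: w).
    by rewrite SM; exists (right_end w); rewrite //= in_itv /= lexx lrw.
  rewrite SL => -[c /=]; rewrite in_itv /= => /andP[_ cr] <-; rewrite !phiZ => dw.
  have [|x + /phi_dist] := LtoM (right_end v *: v).
    by rewrite SL; exists (right_end v); rewrite //= in_itv /= lexx lr.
  rewrite SM => -[c' /=]; rewrite in_itv /= => /andP[_ cr'] <-; rewrite !phiZ => dv.
  have cv : c * phi v <= right_end v * phi v by rewrite ler_pM2r.
  have cw : c' * phi w <= right_end w * phi w by rewrite ler_pM2r.
  move: dw dv; rewrite !ler_norml => /andP[_ h1] /andP[h2 _].
  by apply/andP; split; lra.
have ratio_cont : (right_end w * phi w) / phi w @[w --> v] --> right_end v.
  rewrite -[X in _ --> X](mulfK (lt0r_neq0 phiv)).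
  exact: (cvgM prod_cont (cvgV (lt0r_neq0 phiv) phi_cont)).
have near_eq : {near nbhs v, (fun w => right_end w * phi w / phi w) =1 right_end}.
  by apply: filterS near_phi => w phiw; rewrite mulfK // gt_eqF.
exact: (cvg_trans (near_eq_cvg near_eq) ratio_cont).
Qed.

Lemma left_end_continuous v : v != 0 -> {for v, continuous left_end}.
Proof.
move=> v0; have Nv0 : - v != 0 by rewrite oppr_eq0.
exact: (cvgN (for_continuous_opp (right_end_continuous Nv0))).
Qed.

End SegmentFamily.

(** * Comparing several segments on one line *)

Lemma fiber_line (R : realType) n (V : set (canonical_line_bundle R n)) L x :
  fiber V L x -> x \in sval L.
Proof.
move=> [p _ pLx]; suff : canonical_line_bundle R n (L, x) by [].
by rewrite -pLx; exact: set_valP.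
Qed.

Lemma continuous_bigmaxr (R : realType) (T : topologicalType) (I : Type)
    (r : seq I) (h : T -> R) (f : I -> T -> R) x :
  {for x, continuous h} -> (forall i, {for x, continuous (f i)}) ->
  {for x, continuous (fun y => \big[Num.max/h y]_(i <- r) f i y)}.
Proof.
move=> h_cont f_cont; elim: r => [|i r IH].
  rewrite (_ : (fun y => _) = h) //.
  by apply/funext => y; rewrite big_nil.
rewrite (_ : (fun y => _) = f i \max (fun y => \big[Num.max/h y]_(i <- r) f i y)).
  exact: (@continuous_max R T).
by apply/funext => y; rewrite big_cons.
Qed.

Section SegmentFamilies.
Context (R : realType) (n : nat) (I : finType).
Variable S : I -> grassmannian1 R n -> set 'rV[R]_n.
Hypothesis S_line : forall i L x, S i L x -> x \in sval L.
Hypothesis S_segment : forall i L, is_segment (S i L).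
Implicit Types (i j : I) (v w : 'rV[R]_n) (L : grassmannian1 R n).

(* [innermost i (- v)] says that the right end of [S i] is the smallest one. *)
Definition innermost i v := forall j, left_end (S j) v <= left_end (S i) v.

Let ends i v L := @slice_ends _ _ (S i) (@S_line i) (@S_segment i) v L.

Lemma innermost_scale i v (c : R) : v != 0 -> 0 < c -> innermost i v ->
  innermost i (c *: v).
Proof.
move=> v0 c0 iv j; have Nv0 : - v != 0 by rewrite oppr_eq0.
have left_scale k : left_end (S k) (c *: v) = left_end (S k) v / c.
  rewrite /left_end -scalerN mulNr; congr (- _).
  exact: (right_end_scale (@S_line k) (@S_segment k) Nv0 c0).
by rewrite !left_scale ler_pM2r ?invr_gt0.
Qed.

Lemma innermostN i v : innermost i (- v) ->
  forall j, right_end (S i) v <= right_end (S j) v.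
Proof. by move=> iNv j; have := iNv j; rewrite !left_endN lerN2. Qed.

Lemma innermost_sub i v L : v != 0 -> sval L = <[v]>%VS ->
  innermost i v -> innermost i (- v) -> forall j, S i L `<=` S j L.
Proof.
move=> v0 Lv iv /innermostN iNv j.
have [[_ ->] [_ ->]] := (ends i v0 Lv, ends j v0 Lv).
move=> x [c /=]; rewrite in_itv /= => /andP[lc cr] <-; exists c => //=.
by rewrite in_itv /= (le_trans (iv j) lc) (le_trans cr (iNv j)).
Qed.

(** All of [F] share the largest left end and all of [G] the smallest right end. If these ends are
    not separated, every segment starts before the former and stops after the latter, so it contains
    the stretch between them. *)
Lemma innermost_equalized_a (F G : set I) v L : v != 0 -> sval L = <[v]>%VS ->
  F !=set0 -> G !=set0 ->
  (forall i, F i -> innermost i v) -> (forall i, G i -> innermost i (- v)) ->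
  equalized_a v [set S i L | i in G] [set S i L | i in F].
Proof.
move=> v0 Lv [i0 Fi0] [j0 Gj0] Fv Gv.
have left_i0 i : F i -> left_end (S i) v = left_end (S i0) v.
  by move=> Fi; apply/eqP; rewrite eq_le (Fv i Fi i0) (Fv i0 Fi0 i).
have right_j0 j : G j -> right_end (S j) v = right_end (S j0) v.
  move=> Gj; apply/eqP.
  by rewrite eq_le (innermostN (Gv j Gj) j0) (innermostN (Gv j0 Gj0) j).
exists (right_end (S j0) v *: v), (left_end (S i0) v *: v); split.
- move=> _ [j Gj <-]; rewrite -(right_j0 j Gj); have [lr ->] := ends j v0 Lv.
  split; first by exists (right_end (S j) v); rewrite //= in_itv /= lr lexx.
  move=> x [c /=]; rewrite in_itv /= => /andP[_]; rewrite le_eqVlt.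
  move=> /predU1P[->|cr] <-; [by left|right].
  by exists (right_end (S j) v - c); rewrite ?subr_gt0 // -scalerDl addrC subrK.
- move=> _ [i Fi <-]; rewrite -(left_i0 i Fi); have [lr ->] := ends i v0 Lv.
  split; first by exists (left_end (S i) v); rewrite //= in_itv /= lr lexx.
  move=> x [c /=]; rewrite in_itv /= => /andP[]; rewrite le_eqVlt.
  move=> /predU1P[->|lc] _ <-; [by left|right].
  by exists (c - left_end (S i) v); rewrite ?subr_gt0 // -scalerDl addrC subrK.
- have [rl|lr] := ltP (right_end (S j0) v) (left_end (S i0) v).
    left; exists (left_end (S i0) v - right_end (S j0) v); first by rewrite subr_gt0.
    by rewrite -scalerDl addrC subrK.
  right=> _ [[k _ <-]|[k _ <-]]; rewrite segment_scale //; have [_ ->] := ends k v0 Lv.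
    move=> x [c /=]; rewrite in_itv /= => /andP[lc cr] <-; exists c => //=.
    rewrite in_itv /= (le_trans (Fv i0 Fi0 k) lc).
    by rewrite (le_trans cr (innermostN (Gv j0 Gj0) k)).
  move=> x [c /=]; rewrite in_itv /= => /andP[lc cr] <-; exists c => //=.
  rewrite in_itv /= (le_trans (Fv i0 Fi0 k) lc).
  by rewrite (le_trans cr (innermostN (Gv j0 Gj0) k)).
Qed.

Lemma innermost_equalized (F G : set I) v L : v != 0 -> sval L = <[v]>%VS ->
  F !=set0 -> G !=set0 ->
  (forall i, F i -> innermost i v) -> (forall i, G i -> innermost i (- v)) ->
  forall u, u \in sval L -> u <> 0 ->
  equalized u [set S i L | i in F] [set S i L | i in G].
Proof.
move=> v0 Lv F0 G0 Fv Gv u + /eqP u0; rewrite Lv => /vlineP[c uc].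
have Nv0 : - v != 0 by rewrite oppr_eq0.
have c0 : c != 0 by apply: contraNneq u0 => c0; rewrite uc c0 scale0r.
have Lu : sval L = <[u]>%VS.
  rewrite Lv uc; apply: subv_anti; rewrite -!memvE memvZ ?memv_line // andbT.
  by rewrite -[X in X \in _](scalerK c0) memvZ ?memv_line.
(* The sign of [c] tells whether [u] agrees with [v] or reverses it, and so which disjunct holds. *)
have [c_lt0|c_gt0|c_eq0] := ltgtP c 0; last by rewrite c_eq0 eqxx in c0.
- left; have uNc : u = - c *: - v by rewrite scaleNr scalerN opprK.
  have Nc0 : 0 < - c by rewrite oppr_gt0.
  apply: innermost_equalized_a => // i iP.
    by rewrite uNc; apply: innermost_scale => //; exact: Gv.
  by rewrite uNc -scalerN opprK; apply: innermost_scale => //; exact: Fv.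
- right; apply: innermost_equalized_a => // i iP; rewrite uc.
    by apply: innermost_scale => //; exact: Fv.
  by rewrite -scalerN; apply: innermost_scale => //; exact: Gv.
Qed.

End SegmentFamilies.

Theorem theorem2p4 (R : realType) (n : nat) (hn : (1 <= n)%N)
    (V : 'I_n.+1 -> set (canonical_line_bundle R n))
    (Vclosed : forall i, closed (V i))
    (Vsegment : forall L i, is_segment (fiber (V i) L))
    (Vcontinuous : forall i, hausdorff_continuous (fiber (V i))) :
  (exists (L : grassmannian1 R n) (i : 'I_n.+1),
      forall j, j <> i -> fiber (V i) L `<=` fiber (V j) L) \/
  (forall F1 F2 : set 'I_n.+1,
      F1 !=set0 -> F2 !=set0 -> F1 `|` F2 = setT -> F1 `&` F2 = set0 ->
      exists L : grassmannian1 R n,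
        forall u : 'rV[R]_n, u \in sval L -> u <> 0 ->
          equalized u [set fiber (V i) L | i in F1]
                      [set fiber (V i) L | i in F2]).
Proof.
case: n hn V Vclosed Vsegment Vcontinuous => // d _ V _ Vseg Vcont.
pose S i := fiber (V i).
have S_line i L x : S i L x -> x \in sval L by exact: fiber_line.
have S_seg i L : is_segment (S i L) by exact: Vseg.
(* The default value is itself one of the left ends, so [m v] is always attained and [g i] vanishes
   for some [i]. *)
pose m v := \big[Num.max/left_end (S ord0) v]_j left_end (S j) v.
pose g i v := m v - left_end (S i) v.
have le_m i v : left_end (S i) v <= m v by exact: le_bigmax.
have gP i v : g i v = 0 <-> innermost S i v.
  split=> [/eqP|iv].
    by rewrite subr_eq0 => /eqP miv j; rewrite -miv.
  apply/eqP; rewrite subr_eq0 eq_le le_m andbT.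
  by apply/bigmax_leP; split=> // j _; exact: iv.
have left_cont i v : v != 0 -> {for v, continuous (left_end (S i))}.
  by move=> v0; exact: (left_end_continuous (@S_line i) (S_seg i) (Vcont i) v0).
have [[v [i [v0 iv iNv]]]|no_min] := pselect (exists v i,
    [/\ v != 0, innermost S i v & innermost S i (- v)]).
  left; have [L Lv] := line_exists v0; exists L, i => j _.
  exact: innermost_sub Lv iv iNv j.
right=> F G F0 G0 FG FG0.
have [|||i v v0 /gP iv /gP iNv|v v0 [Fv Gv]] :=
  @antipodal_partition R d g _ _ _ _ F G F0 G0 FG FG0.
- move=> i v v0; apply: (cvgB _ (left_cont i v v0)).
  by apply: continuous_bigmaxr => *; exact: left_cont.
- by move=> i v _; rewrite subr_ge0.
- move=> v _; suff [i mi] : exists i, m v = left_end (S i) v.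
    by exists i; rewrite /g mi subrr.
  apply: (big_ind (fun x => exists i, x = left_end (S i) v)).
  + by exists ord0.
  + by move=> x y [i ->] [j ->]; rewrite /Num.max; case: ifP => _; [exists j|exists i].
  + by move=> i _; exists i.
- by apply: no_min; exists v, i.
have [L Lv] := line_exists v0; exists L.
apply: (innermost_equalized S_line S_seg v0 Lv F0 G0) => i iP; apply/gP.
  exact: Fv.
exact: Gv.
Qed.
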